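(* If $G=(V_1\cup V_2,E)$ is a simple, connected, biregular bipartite, edge-rigid graph with at least one edge, then $G$ is walk-biregular.
   Context: $V_1,V_2$ are the parts of the bipartition; vertices in $V_1$ have degree $d_1$ and vertices in $V_2$ degree $d_2$. Laplacian $L=\sum_{ab\in E}(e_a-e_b)(e_a-e_b)^T$; $\mathcal{L}^*(X)_{ab}=X_{aa}+X_{bb}-2X_{ab}$ for symmetric $X$. With spectral decomposition $L=\sum_{i=1}^r\lambda_iE_i$ (distinct eigenvalues $0=\lambda_1<\dots<\lambda_r$, orthogonal eigenprojectors $E_i$), $G$ is edge-rigid if for each $i\in\{2,\dots,r\}$ there is $\gamma_i>0$ with $\mathcal{L}^*(E_i)=\gamma_i\mathbf{1}$. $G$ is walk-biregular if for every $\ell\ge0$ there are constants $\alpha_\ell^{(1)},\alpha_\ell^{(2)}$ such that the number of closed walks of length $\ell$ starting at any $a\in V_1$ is $\alpha^{(1)}_\ell$ and at any $b\in V_2$ is $\alpha^{(2)}_\ell$. *)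

(* Defs.v *)
From HB Require Import structures.
From mathcomp Require Import all_boot all_order all_algebra.
From mathcomp Require Import reals.
Set Implicit Arguments.
Unset Strict Implicit.
Unset Printing Implicit Defensive.
Import Order.TTheory GRing.Theory Num.Theory.
Local Open Scope ring_scope.

(* A finite simple graph is a finite vertex type T with a symmetric and
   irreflexive adjacency relation e.  Matrices indexed by the vertices are
   'M[R]_#|T|, vertex a having index enum_rank a. *)

Definition simple_graph (T : finType) (e : rel T) : Prop :=
  symmetric e /\ irreflexive e.

Definition connected_graph (T : finType) (e : rel T) : Prop :=
  forall a b : T, connect e a b.

Definition bipartition (T : finType) (e : rel T) (V1 V2 : {set T}) : Prop :=
  [/\ V1 :|: V2 = [set: T],
      [disjoint V1 & V2] &
      forall a b : T, e a b ->
        (a \in V1) && (b \in V2) || (a \in V2) && (b \in V1)].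

Definition degree (T : finType) (e : rel T) (a : T) : nat :=
  #|[set b | e a b]|.

Definition biregular (T : finType) (e : rel T) (V1 V2 : {set T})
    (d1 d2 : nat) : Prop :=
  (forall a, a \in V1 -> degree e a = d1) /\
  (forall b, b \in V2 -> degree e b = d2).

Definition basis_vec (R : realType) (T : finType) (a : T) : 'cV[R]_#|T| :=
  delta_mx (enum_rank a) 0.

(* The comparison of ranks selects exactly one of the two ordered pairs
   representing an undirected edge; the summand is symmetric in p.1, p.2. *)
Definition laplacian (R : realType) (T : finType) (e : rel T) :
    'M[R]_#|T| :=
  \sum_(p : T * T | e p.1 p.2 && (enum_rank p.1 < enum_rank p.2)%N)
    (basis_vec R p.1 - basis_vec R p.2) *m
    (basis_vec R p.1 - basis_vec R p.2)^T.

(* The entry of the adjoint Laplacian map at the pair a, b; it is only used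
   when ab is an edge. *)
Definition laplacian_adj (R : realType) (T : finType) (X : 'M[R]_#|T|)
    (a b : T) : R :=
  X (enum_rank a) (enum_rank a) + X (enum_rank b) (enum_rank b)
    - 2 * X (enum_rank a) (enum_rank b).

(* kermx U^T is the orthogonal complement of the row space of U, so for
   symmetric M this is the matrix of the orthogonal projection onto the
   eigenspace of M for lambda. *)
Definition eigenprojector (R : realType) (n : nat) (M : 'M[R]_n)
    (lambda : R) : 'M[R]_n :=
  proj_mx (eigenspace M lambda) (kermx (eigenspace M lambda)^T).

(* The Laplacian is positive semidefinite and annihilates the all-ones vector,
   so its nonzero eigenvalues are all its eigenvalues but the smallest one. *)
Definition edge_rigid (R : realType) (T : finType) (e : rel T) : Prop :=
  forall lambda : R,
    eigenvalue (laplacian R e) lambda -> lambda != 0 ->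
    exists gamma : R, 0 < gamma /\
      forall a b : T, e a b ->
        laplacian_adj (eigenprojector (laplacian R e) lambda) a b = gamma.

(* A walk of length l from a is given by its l vertices after a. *)
Definition closed_walks (T : finType) (e : rel T) (l : nat) (a : T) :
    {set l.-tuple T} :=
  [set w : l.-tuple T | path e a w && (last a w == a)].

Definition walk_biregular (T : finType) (e : rel T) (V1 V2 : {set T}) : Prop :=
  forall l : nat, exists alpha1 alpha2 : nat,
    (forall a, a \in V1 -> #|closed_walks e l a| = alpha1) /\
    (forall b, b \in V2 -> #|closed_walks e l b| = alpha2).

(* Main.v *)
Require Import Defs.
From mathcomp Require Import all_boot all_order all_algebra.
From mathcomp Require Import reals spectral sesquilinear complex ring lra.

(** Write D for the degree, A for the adjacency matrix, and let E be the
    eigenprojector of L = D - A for lambda, with diagonal x.  Since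
    A E = (D - lambda) E and A exchanges the two sides, every A^l acts on E by a
    factor that depends only on l and on the side, so, the eigenprojectors adding
    up to the identity, it suffices to show that x is constant on each side.
    Summing the edge-rigidity condition over the neighbours of a vertex gives
    A x = gamma D + (D - 2 lambda) x, and subtracting from x its mean on each
    side leaves u with A u = (D - 2 lambda) u.

    Let mu = d1 + d2 - lambda, whose eigenprojector E' (possibly 0) has centered
    diagonal v, and let S be the sign 1 on V1 and -1 on V2.  Multiplication by
    S (D - lambda) maps lambda-eigenfunctions to mu-eigenfunctions, so E' fixes
    the columns of S (D - lambda) E, and likewise E those of S (D - mu) E'.  If
    lambda <> mu, adding the two resulting diagonals and using E' E = 0 yields
    p u = q v on V1 and q u = p v on V2, where p = d1 - lambda and
    q = d2 - lambda; together with the equations for A u and A v this forces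
    u = 0.  If lambda = mu, rescaling u on each side gives a harmonic function,
    hence a constant by connectedness. *)

Set Implicit Arguments.
Unset Strict Implicit.
Unset Printing Implicit Defensive.
Import Order.TTheory GRing.Theory Num.Theory.
Local Open Scope ring_scope.

(** Over [R[i]] the matrix is hermitian, hence unitarily diagonalizable with real spectrum. So its
    minimal polynomial divides a product of distinct linear factors with real roots, and this
    divisibility descends to [R]. *)
Lemma symmetric_diagonalizable (R : rcfType) n (M : 'M[R]_n) :
  M^T = M -> diagonalizable M.
Proof.
case: n M => [|n] M symM; first by rewrite thinmx0; exact: diagonalizable0.
pose f : {rmorphism R -> R[i]} := real_complex R.
have symC : map_mx f M \is hermsymmx.
  apply: realsym_hermsym.
    by apply/is_hermitianmxP; rewrite expr0 scale1r map_mx_id // map_trmx symM.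
  by apply/mxOverP => i j; rewrite mxE complex_real.
have realD := hermitian_spectral_diag_real symC.
have /orthomx_spectralP defM := hermitian_normalmx symC.
set D := spectral_diag _ in realD defM.
pose d i := complex.Re (D 0 i).
have defD i : D 0 i = f (d i).
  by have /mxOverP/(_ 0 i) := realD; rewrite /d => /RRe_real.
apply/diagonalizableP; exists (undup [seq d i | i <- enum 'I_n.+1]).
  exact: undup_uniq.
rewrite -(dvdp_map f) -mxminpoly_map defM -conjVmx ?spectral_unit //.
rewrite mxminpoly_uconj ?unitmx_inv ?spectral_unit // mxminpoly_diag.
rewrite rmorph_prod /= (eq_map defD) (map_comp f d).
rewrite (undup_map_inj (@complexI R)) big_map.
by under eq_bigr do rewrite -map_polyXsubC /=; rewrite dvdpp.
Qed.

(** * Orthogonal eigenprojectors of a real symmetric matrix *)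

Section Eigenprojector.

Variables (R : realType) (n : nat) (M : 'M[R]_n).

Lemma row_mul_tr_eq0 (v : 'rV[R]_n) : v *m v^T = 0 -> v = 0.
Proof.
move=> /matrixP/(_ 0 0); rewrite !mxE => vv0.
apply/rowP => i; rewrite mxE.
have : v 0 i * v^T i 0 = 0.
  apply/eqP; move: (@psumr_eq0P _ _ xpredT (fun i => v 0 i * v^T i 0)).
  by move=> /(_ _ vv0 i isT) -> // j _; rewrite mxE -expr2 sqr_ge0.
by rewrite mxE => /eqP; rewrite mulf_eq0 orbb => /eqP.
Qed.

(** A vector in both spaces is orthogonal to itself, so the sum of its squared entries is zero. *)
Lemma capmx_kermx_tr (U : 'M[R]_n) : (U :&: kermx U^T = 0)%MS.
Proof.
apply/eqP; rewrite -submx0; apply/rV_subP => v; rewrite sub_capmx => /andP[].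
case/submxP=> w defv /sub_kermxP vU; rewrite submx0; apply/eqP.
by apply: row_mul_tr_eq0; rewrite {2}defv trmx_mul mulmxA vU mul0mx.
Qed.

Lemma addsmx_kermx_tr (U : 'M[R]_n) : (U + kermx U^T :=: 1%:M)%MS.
Proof.
apply/eqmxP; rewrite submx1 sub1mx /row_full.
rewrite mxrank_disjoint_sum ?capmx_kermx_tr // mxrank_ker mxrank_tr.
by rewrite subnKC ?rank_leq_row //=.
Qed.

Lemma eigenprojector_id m lambda (v : 'M[R]_(m, n)) :
  v *m M = lambda *: v -> v *m eigenprojector M lambda = v.
Proof.
by move=> /eigenspaceP vM; rewrite proj_mx_id ?capmx_kermx_tr.
Qed.

Lemma eigenprojector_mul lambda :
  eigenprojector M lambda *m M = lambda *: eigenprojector M lambda.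
Proof.
by apply/eigenspaceP; rewrite -[X in (X <= _)%MS]mul1mx; exact: proj_mx_sub.
Qed.

(** The rows of [1 - E] are orthogonal to the eigenspace, which contains the rows of [E]; hence
    [E *m E^T = E^T], and the left side is symmetric. *)
Lemma eigenprojector_sym lambda :
  (eigenprojector M lambda)^T = eigenprojector M lambda.
Proof.
set E := eigenprojector M lambda.
have EET : E *m E^T = E^T.
  have : (E <= eigenspace M lambda)%MS by apply/eigenspaceP/eigenprojector_mul.
  case/submxP=> W {2 3}->; rewrite trmx_mul mulmxA; congr (_ *m _).
  apply/esym/eqP; rewrite -subr_eq0 -{1}[_^T]mul1mx -mulmxBl; apply/eqP.
  apply/sub_kermxP; rewrite -[E]mul1mx; apply: proj_mx_compl_sub.
  by rewrite addsmx_kermx_tr.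
by rewrite -[RHS]trmxK -EET (trmx_mul E) trmxK.
Qed.

Lemma eigenprojector_eq0 lambda :
  ~~ eigenvalue M lambda -> eigenprojector M lambda = 0.
Proof.
rewrite negbK => /eqP V0; apply/eqP; rewrite -submx0 -V0.
by apply/eigenspaceP; exact: eigenprojector_mul.
Qed.

Hypothesis symM : M^T = M.

Lemma eigenprojector_orthogonal lambda mu : lambda != mu ->
  eigenspace M mu *m eigenprojector M lambda = 0.
Proof.
move=> lambdaDmu; have symE := eigenprojector_sym lambda.
set V := eigenspace M mu; set E := eigenprojector M lambda.
have VM : V *m M = mu *: V by apply/eigenspaceP.
have ME : M *m E = lambda *: E.
  by rewrite -[LHS]trmxK trmx_mul symM symE eigenprojector_mul linearZ /= symE.
have : (lambda - mu) *: (V *m E) = 0.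
  by rewrite scalerBl (scalemxAl mu) -VM -(mulmxA V M) ME -scalemxAr subrr.
by move=> /eqP; rewrite scaler_eq0 subr_eq0 (negPf lambdaDmu) => /eqP.
Qed.

(** By diagonalizability the identity is a combination of eigenvectors, each fixed by its own
    projector and killed by the others. *)
Lemma eigenprojector_sum :
  exists rs : seq R, \sum_(r <- rs) eigenprojector M r = 1%:M.
Proof.
have /diagonalizablePeigen[rs uniq_rs full_rs] := symmetric_diagonalizable symM.
exists rs; have : (1%:M <= \sum_(r <- rs) eigenspace M r)%MS by rewrite full_rs.
rewrite [in X in (_ <= X)%MS](big_nth 0) big_mkord.
case/sub_sumsmxP=> W defW; rewrite -[LHS]mul1mx [RHS]defW [in LHS]defW.
rewrite mulmx_suml; apply: eq_bigr => i _; rewrite -mulmxA; congr (_ *m _).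
rewrite mulmx_sumr (bigD1_seq (nth 0 rs i)) ?mem_nth //= big1 => [|r rDi].
  by rewrite addr0 eigenprojector_id //; apply/eigenspaceP.
exact: eigenprojector_orthogonal.
Qed.

End Eigenprojector.

(** * Eigenfunctions of the Laplacian *)

Section LaplacianEigenfunctions.

Variables (R : realType) (T : finType) (e : rel T).
Hypotheses (sym_e : symmetric e) (irr_e : irreflexive e).

Definition laplacian_eigenfunction (lambda : R) (f : T -> R) :=
  forall a, \sum_(b | e a b) (f a - f b) = lambda * f a.

Definition eigenprojector_entry (lambda : R) (a b : T) : R :=
  eigenprojector (laplacian R e) lambda (enum_rank a) (enum_rank b).

Lemma mul_tr_basis_vecB (p q : T) (v : 'cV[R]_#|T|) :
  ((basis_vec R p - basis_vec R q)^T *m v) 0 0 =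
  v (enum_rank p) 0 - v (enum_rank q) 0.
Proof. by rewrite linearB /= !trmx_delta mulmxBl -!rowE !mxE. Qed.

Lemma laplacian_sym : (laplacian R e)^T = laplacian R e.
Proof.
rewrite /laplacian linear_sum /=; apply: eq_bigr => p _.
by rewrite trmx_mul trmxK.
Qed.

(** Each edge at [a] occurs once in the Laplacian, with [a] as its end of lower or of higher rank;
    the two cases together exhaust the neighbours of [a]. *)
Lemma mul_laplacian (v : 'cV[R]_#|T|) (a : T) :
  (laplacian R e *m v) (enum_rank a) 0 =
  \sum_(b | e a b) (v (enum_rank a) 0 - v (enum_rank b) 0).
Proof.
pose F a b := v (enum_rank a) 0 - v (enum_rank b) 0.
pose lt (a b : T) := (enum_rank a < enum_rank b)%N : bool.
have delta_sum (P : pred T) (G : T -> R) :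
    \sum_(x | P x) (a == x)%:R * G x = (P a)%:R * G a.
  rewrite big_mkcond (bigD1 a) //= big1 => [|x /negPf xa].
    by rewrite eqxx addr0; case: (P a); rewrite ?mul1r ?mul0r.
  by rewrite eq_sym xa mul0r if_same.
have term p : ((basis_vec R p.1 - basis_vec R p.2) *m
    (basis_vec R p.1 - basis_vec R p.2)^T *m v) (enum_rank a) 0 =
    (a == p.1)%:R * F p.1 p.2 + (a == p.2)%:R * F p.2 p.1.
  rewrite -mulmxA mxE big_ord1 mul_tr_basis_vecB !mxE !andbT.
  by rewrite !(inj_eq enum_rank_inj) /F; ring.
rewrite /laplacian mulmx_suml summxE (eq_bigr _ (fun p _ => term p)).
rewrite big_split /=.
rewrite -(pair_big_dep xpredT (fun x y => e x y && lt x y)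
  (fun x y => (a == x)%:R * F x y)) /=.
rewrite -(pair_big_dep xpredT (fun x y => e x y && lt x y)
  (fun x y => (a == y)%:R * F y x)) /=.
have -> : \sum_x \sum_(y | e x y && lt x y) (a == x)%:R * F x y =
    \sum_(b | e a b && lt a b) F a b.
  rewrite (bigD1 a) //= [X in _ + X]big1 => [|x /negPf xa]; last first.
    by rewrite big1 // => y _; rewrite eq_sym xa mul0r.
  by rewrite addr0; apply: eq_bigr => y _; rewrite eqxx mul1r.
have -> : \sum_x \sum_(y | e x y && lt x y) (a == y)%:R * F y x =
    \sum_(b | e a b && lt b a) F a b.
  rewrite [RHS]big_mkcond; apply: eq_bigr => x _.
  rewrite (delta_sum _ (fun y => F y x)) sym_e.
  by case: ifP => _; rewrite ?mul1r ?mul0r.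
rewrite [RHS](bigID (lt a)) /=; congr (_ + _); apply: eq_bigl => b.
case eab: (e a b) => //=; rewrite /lt -leqNgt ltn_neqAle.
have -> // : enum_rank b != enum_rank a :> nat.
by apply: contraTneq eab => /val_inj/enum_rank_inj->; rewrite irr_e.
Qed.

Lemma eigenprojector_entry_sym lambda a b :
  eigenprojector_entry lambda a b = eigenprojector_entry lambda b a.
Proof. by rewrite /eigenprojector_entry -[in LHS]eigenprojector_sym mxE. Qed.

Lemma eigenprojector_entry_eigen lambda c :
  laplacian_eigenfunction lambda (eigenprojector_entry lambda ^~ c).
Proof.
move=> a; set E := eigenprojector (laplacian R e) lambda.
have LE : laplacian R e *m E = lambda *: E.
  rewrite -[LHS]trmxK trmx_mul laplacian_sym eigenprojector_sym.
  rewrite eigenprojector_mul linearZ /=. by rewrite eigenprojector_sym.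
have colV b :
    col (enum_rank c) E (enum_rank b) 0 = eigenprojector_entry lambda b c.
  by rewrite mxE.
have := mul_laplacian (col (enum_rank c) E) a; rewrite !colV.
have -> : laplacian R e *m col (enum_rank c) E = lambda *: col (enum_rank c) E.
  by rewrite colE mulmxA LE scalemxAl.
rewrite [in LHS]mxE colV => ->.
by apply: eq_bigr => b _; rewrite colV.
Qed.

Lemma eigenprojector_entry_fix lambda f : laplacian_eigenfunction lambda f ->
  forall a, \sum_b eigenprojector_entry lambda a b * f b = f a.
Proof.
move=> eigf a; pose v : 'cV[R]_#|T| := \col_i f (enum_val i).
have vE b : v (enum_rank b) 0 = f b by rewrite mxE enum_rankK.
have Lv : laplacian R e *m v = lambda *: v.
  apply/colP => i; rewrite -(enum_valK i) mul_laplacian.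
  by rewrite [RHS]mxE vE -eigf; apply: eq_bigr => b _; rewrite !vE.
have Ev : eigenprojector (laplacian R e) lambda *m v = v.
  apply: (can_inj (@trmxK _ _ _)); rewrite trmx_mul eigenprojector_sym.
  apply: eigenprojector_id.
  by rewrite -[laplacian _ _]laplacian_sym -trmx_mul Lv linearZ.
rewrite -vE -[in RHS]Ev mxE (reindex (@enum_rank T)) /=; last first.
  by apply: onW_bij; exact: enum_rank_bij.
by apply: eq_bigr => b _; rewrite vE.
Qed.

Lemma eigenprojector_entry_sum : exists rs : seq R,
  forall a b, \sum_(r <- rs) eigenprojector_entry r a b = (a == b)%:R.
Proof.
have [rs sum_rs] := eigenprojector_sum laplacian_sym; exists rs => a b.
have /matrixP/(_ (enum_rank a) (enum_rank b)) := sum_rs.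
by rewrite summxE mxE (inj_eq enum_rank_inj).
Qed.

Hypothesis conn_e : connected_graph e.

(** The Dirichlet energy [S] splits into two sums that vanish by harmonicity, so [f] agrees across
    every edge. *)
Lemma harmonic_const f : laplacian_eigenfunction 0 f -> forall a b, f a = f b.
Proof.
move=> harm_f; pose S := \sum_a \sum_(b | e a b) (f a - f b) ^+ 2.
have part1 : \sum_a \sum_(b | e a b) f a * (f a - f b) = 0.
  by rewrite big1 // => a _; rewrite -mulr_sumr harm_f mul0r mulr0.
have part2 : \sum_a \sum_(b | e a b) f b * (f b - f a) = 0.
  rewrite (exchange_big_dep predT) //= -[RHS]part1; apply: eq_bigr => a _.
  by apply: eq_bigl => b; rewrite sym_e.
have S0 : S = 0.
  have -> : S = \sum_a (\sum_(b | e a b) f a * (f a - f b) +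
      \sum_(b | e a b) f b * (f b - f a)).
    apply: eq_bigr => a _; rewrite -big_split /=.
    by apply: eq_bigr => b _; ring.
  by rewrite big_split /= part1 part2 addr0.
have edge a b : e a b -> f a = f b.
  have sq_ge0 x : 0 <= \sum_(y | e x y) (f x - f y) ^+ 2.
    by apply: sumr_ge0 => y _; exact: sqr_ge0.
  have Sa : \sum_(y | e a y) (f a - f y) ^+ 2 = 0.
    by apply: (psumr_eq0P _ S0).
  move=> eab; apply/eqP; rewrite -subr_eq0 -sqrf_eq0; apply/eqP.
  exact: (psumr_eq0P (fun y _ => sqr_ge0 (f a - f y)) Sa).
move=> a b; have /connectP[p + ->] := conn_e a b.
by elim: p a => //= c p IHp a /andP[/edge-> /IHp].
Qed.

Hypothesis rigid : edge_rigid R e.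

(** Rigidity extends to every real [lambda], since the dual of an eigenvalue may be 0 or no
    eigenvalue at all. At 0 the columns of the projector are constant; off the spectrum the
    projector vanishes. *)
Lemma edge_rigid_all lambda : exists gamma, forall a b, e a b ->
  eigenprojector_entry lambda a a + eigenprojector_entry lambda b b
    - 2 * eigenprojector_entry lambda a b = gamma.
Proof.
have [->|lambda0] := eqVneq lambda 0.
  exists 0 => a b _.
  have const c := harmonic_const (@eigenprojector_entry_eigen 0 c).
  by rewrite (const b b a) (const a a b) [_ b a]eigenprojector_entry_sym; ring.
have [eig|neig] := boolP (eigenvalue (laplacian R e) lambda).
  by have [gamma [_ gammaP]] := rigid eig lambda0; exists gamma => a b /gammaP.
exists 0 => a b _; rewrite /eigenprojector_entry eigenprojector_eq0 // !mxE.
by ring.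
Qed.

End LaplacianEigenfunctions.

(** * Biregular bipartite graphs *)

Section Biregular.

Variables (R : realType) (T : finType) (e : rel T).
Variables (side : T -> bool) (D : bool -> R).
Hypothesis sym_e : symmetric e.
Hypothesis side_e : forall a b, e a b -> side b = ~~ side a.
Hypothesis deg_e : forall a, \sum_(b | e a b) (1 : R) = D (side a).
Hypothesis D_gt0 : forall s, 0 < D s.
Hypothesis occ_side : forall s, exists a, side a = s.

Let degM a (c : R) : \sum_(b | e a b) c = D (side a) * c.
Proof. by rewrite -deg_e mulr_suml; apply: eq_bigr => b _; rewrite mul1r. Qed.

Lemma laplacian_eigenfunctionP lambda f :
  laplacian_eigenfunction e lambda f <->
  forall a, \sum_(b | e a b) f b = (D (side a) - lambda) * f a.
Proof.
have defL a : \sum_(b | e a b) (f a - f b) =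
    D (side a) * f a - \sum_(b | e a b) f b by rewrite sumrB degM.
by split=> eigf a; have := eigf a; rewrite defL; move: (\sum_(b | _) _) => ?; lra.
Qed.

Lemma sum_adjacency f s :
  \sum_(a | side a == s) \sum_(b | e a b) f b =
  D (~~ s) * \sum_(b | side b == ~~ s) f b.
Proof.
rewrite (exchange_big_dep (fun b => side b == ~~ s)) /=; last first.
  by move=> a b /eqP <- /side_e ->.
rewrite mulr_sumr; apply: eq_bigr => b /eqP sb; rewrite -sb -degM.
apply: eq_bigl => a; rewrite sym_e andbC; case eba: (e b a) => //=.
by rewrite (side_e eba) sb negbK eqxx.
Qed.

(** Symmetry of the adjacency matrix, tested on [f] and [g]; the degree terms cancel and leave the
    factor [mu - lambda]. *)
Lemma eigenfunction_orthogonal (lambda mu : R) (f g : T -> R) : lambda != mu ->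
  laplacian_eigenfunction e lambda f -> laplacian_eigenfunction e mu g ->
  \sum_a f a * g a = 0.
Proof.
move=> neq /laplacian_eigenfunctionP eigf /laplacian_eigenfunctionP eigg.
have : \sum_a \sum_(b | e a b) f b * g a = \sum_a \sum_(b | e a b) f a * g b.
  rewrite (exchange_big_dep predT) //=; apply: eq_bigr => a _.
  by apply: eq_bigl => b; rewrite sym_e.
under eq_bigr do rewrite -mulr_suml eigf.
under [RHS]eq_bigr do rewrite -mulr_sumr eigg.
move/eqP; rewrite -subr_eq0 -sumrB.
rewrite (eq_bigr (fun a => (mu - lambda) * (f a * g a))) => [|a _]; last ring.
by rewrite -mulr_sumr mulf_eq0 subr_eq0 eq_sym (negPf neq) => /eqP.
Qed.

(** * The duality between eigenvalues *)

Definition side_sign (s : bool) : R := if s then 1 else -1.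

Definition dual_eigenvalue (lambda : R) := D true + D false - lambda.

Lemma eigenfunction_dual lambda f : laplacian_eigenfunction e lambda f ->
  laplacian_eigenfunction e (dual_eigenvalue lambda)
    (fun b => side_sign (side b) * (D (side b) - lambda) * f b).
Proof.
move=> /laplacian_eigenfunctionP eigf; apply/laplacian_eigenfunctionP => a.
transitivity (side_sign (~~ side a) * (D (~~ side a) - lambda) *
    \sum_(b | e a b) f b).
  by rewrite mulr_sumr; apply: eq_bigr => b /side_e ->.
by rewrite eigf /dual_eigenvalue; case: (side a) => /=; ring.
Qed.

Hypothesis irr_e : irreflexive e.

Local Notation E := (@eigenprojector_entry R T e).

Lemma diag_dual lambda a : lambda != dual_eigenvalue lambda ->
  (D (side a) - lambda) * E lambda a a =
  (D (~~ side a) - lambda) * E (dual_eigenvalue lambda) a a.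
Proof.
set mu := dual_eigenvalue lambda => neq.
have muK : dual_eigenvalue mu = lambda by rewrite /mu /dual_eigenvalue; ring.
have eigE (r : R) := eigenprojector_entry_eigen sym_e irr_e r.
have fixE r f := @eigenprojector_entry_fix R _ _ sym_e irr_e r f.
have eq1 := fixE _ _ (eigenfunction_dual (eigE lambda a)) a.
have eq2 : laplacian_eigenfunction e lambda
    (fun b => side_sign (side b) * (D (side b) - mu) * E mu b a).
  by rewrite -[lambda]muK; apply: eigenfunction_dual (eigE mu a).
move/fixE/(_ a): eq2 => eq2.
have eq3 : \sum_b E lambda b a * E mu b a = 0.
  exact: eigenfunction_orthogonal neq (eigE lambda a) (eigE mu a).
(* The weights of [eq1] and [eq2] add up to [side_sign * (2 * D - lambda - mu)], which is
   [D true - D false] on both sides. *)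
have : (D true - D false) * \sum_b E lambda b a * E mu b a =
    side_sign (side a) * (D (side a) - lambda) * E lambda a a +
    side_sign (side a) * (D (side a) - mu) * E mu a a.
  rewrite -eq1 -eq2 -big_split mulr_sumr; apply: eq_bigr => b _ /=.
  rewrite [E lambda a b]eigenprojector_entry_sym [E mu a b]eigenprojector_entry_sym.
  by rewrite /mu /dual_eigenvalue; case: (side b) => /=; ring.
rewrite eq3 mulr0 /mu /dual_eigenvalue; case: (side a) => /=; lra.
Qed.

(** * Centering a function on each side *)

Definition side_mean (x : T -> R) (s : bool) : R :=
  (\sum_(b | side b == s) x b) / \sum_(b | side b == s) 1.

Definition centered (x : T -> R) (a : T) : R := x a - side_mean x (side a).

(** The two side means satisfy the same affine equation, because both sides carry equally many edge
    ends ([sum_n]); subtracting it removes [gamma]. *)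
Lemma adjacency_centered x gamma lambda :
  (forall a, \sum_(b | e a b) x b =
     D (side a) * gamma + (D (side a) - 2 * lambda) * x a) ->
  forall a, \sum_(b | e a b) centered x b =
     (D (side a) - 2 * lambda) * centered x a.
Proof.
move=> adjx a; rewrite /centered sumrB adjx.
have -> : \sum_(b | e a b) side_mean x (side b) =
    D (side a) * side_mean x (~~ side a).
  by rewrite -degM; apply: eq_bigr => b /side_e ->.
move: (side a) => s.
pose n s := \sum_(b | side b == s) (1 : R).
pose X s := \sum_(b | side b == s) x b.
have n_neq0 t : n t != 0.
  have [b sb] := occ_side t; rewrite lt0r_neq0 // /n (bigD1 b) ?sb //=.
  by rewrite ltr_pwDl // sumr_ge0.
have sum_n : D s * n s = D (~~ s) * n (~~ s).
  rewrite -sum_adjacency mulr_sumr; apply: eq_bigr => b /eqP <-.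
  by rewrite deg_e mulr1.
have sum_X : D (~~ s) * X (~~ s) =
    D s * gamma * n s + (D s - 2 * lambda) * X s.
  rewrite -sum_adjacency !mulr_sumr -big_split; apply: eq_bigr => b /eqP <- /=.
  by rewrite adjx mulr1.
rewrite /side_mean -!/(n _) -!/(X _).
have eqD : D s = D (~~ s) * n (~~ s) / n s by rewrite -sum_n mulfK.
have : D s * (X (~~ s) / n (~~ s)) =
    D s * gamma + (D s - 2 * lambda) * (X s / n s).
  rewrite [in LHS]eqD.
  transitivity (D (~~ s) * X (~~ s) / n s); first by field; rewrite !n_neq0.
  by rewrite sum_X; field.
by move=> ->; ring.
Qed.

(** * Constancy of projector diagonals on each side *)

Hypothesis conn_e : connected_graph e.
Hypothesis rigid_e : edge_rigid R e.

Lemma adjacency_diag lambda : exists gamma, forall a,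
  \sum_(b | e a b) E lambda b b =
    D (side a) * gamma + (D (side a) - 2 * lambda) * E lambda a a.
Proof.
have [gamma gammaP] := edge_rigid_all sym_e irr_e conn_e rigid_e lambda.
exists gamma => a.
have adjE : \sum_(b | e a b) E lambda a b = (D (side a) - lambda) * E lambda a a.
  have /laplacian_eigenfunctionP <- :=
    eigenprojector_entry_eigen sym_e irr_e lambda a.
  by apply: eq_bigr => b _; rewrite eigenprojector_entry_sym.
have <- : \sum_(b | e a b) (E lambda a a + E lambda b b - 2 * E lambda a b) =
    D (side a) * gamma.
  by rewrite -degM; apply: eq_bigr => b /gammaP.
by rewrite sumrB big_split /= degM -mulr_sumr adjE; ring.
Qed.

Lemma centered_selfdual lambda u : lambda = dual_eigenvalue lambda ->
  (forall a, \sum_(b | e a b) u b = (D (side a) - 2 * lambda) * u a) ->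
  forall a b, side a = side b -> u a = u b.
Proof.
move=> self adju a b sab.
(* Self-duality turns the factor [D s - 2 * lambda] into [- D (~~ s)]; this scaling makes [w] an
   eigenfunction for 0. *)
pose w a := side_sign (side a) * D (~~ side a) * u a.
have harm_w : laplacian_eigenfunction e 0 w.
  apply/laplacian_eigenfunctionP => c.
  transitivity (side_sign (~~ side c) * D (side c) * \sum_(d | e c d) u d).
    rewrite mulr_sumr; apply: eq_bigr => d /side_e sd.
    by rewrite /w sd negbK.
  rewrite adju; have -> : 2 * lambda = D true + D false.
    by move: self; rewrite /dual_eigenvalue; lra.
  by rewrite /w; case: (side c) => /=; ring.
have := harmonic_const sym_e conn_e harm_w a b; rewrite /w sab.
apply: mulfI; rewrite mulf_neq0 ?(gt_eqF (D_gt0 _)) //.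
by rewrite /side_sign; case: ifP => _; rewrite ?oppr_eq0 oner_eq0.
Qed.

Lemma centered_dual_eq0 lambda u v (mu := dual_eigenvalue lambda) : lambda != mu ->
  (forall a, \sum_(b | e a b) u b = (D (side a) - 2 * lambda) * u a) ->
  (forall a, \sum_(b | e a b) v b = (D (side a) - 2 * mu) * v a) ->
  (forall a, (D (side a) - lambda) * u a = (D (~~ side a) - lambda) * v a) ->
  forall a, u a = 0.
Proof.
move=> neq adju adjv uv.
have mu_def : mu = D true + D false - lambda by [].
have sumD s : D s + D (~~ s) = lambda + mu by rewrite mu_def; case: s => /=; ring.
clearbody mu.
pose p s := D s - lambda.
(* The relation [uv], summed over the neighbours of [a], which lie on the other side. *)
have adj_uv a : p (~~ side a) * ((D (side a) - 2 * lambda) * u a) =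
    p (side a) * ((D (side a) - 2 * mu) * v a).
  rewrite -adju -adjv !mulr_sumr; apply: eq_bigr => b /side_e sb.
  by have := uv b; rewrite sb negbK.
(* A nonzero [u b] would force either [D (~~ s) = 2 * lambda = 2 * mu], hence [D s = 0], or
   [D (~~ s) = lambda = 2 * lambda], hence [D (~~ s) = 0]. *)
have half s : (forall a, side a = s -> u a = 0 /\ v a = 0) ->
    forall b, side b = ~~ s -> u b = 0.
  move=> uv0 b sb; have nb c : e b c -> u c = 0 /\ v c = 0.
    by move=> /side_e sc; apply: uv0; rewrite sc sb negbK.
  have := adju b; rewrite big1 => [/esym/eqP|c /nb[]//].
  have := adjv b; rewrite big1 => [/esym/eqP|c /nb[]//].
  have := uv b; rewrite sb negbK !mulf_eq0 => uvb.
  case: (u b =P 0) => // /eqP ub0; case: (v b =P 0) => [vb0 _|_]; last first.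
    rewrite !orbF !subr_eq0 => /eqP Dmu /eqP Dla.
    by have := sumD s; have := D_gt0 s; lra.
  rewrite orbF subr_eq0 => /eqP Dla; move: uvb; rewrite vb0 mulr0 => /eqP.
  rewrite mulf_eq0 (negPf ub0) orbF subr_eq0 => /eqP Dla2.
  by have := D_gt0 (~~ s); lra.
(* Here [D s = lambda] and [D (~~ s) = mu]: [uv] kills [u] on the side [~~ s], and then [adju] reads
   [0 = - lambda * u a] on the side [s]. *)
have degenerate s : p s = 0 -> forall a, u a = 0.
  move=> ps0; have Ds : D s = lambda by apply/eqP; rewrite -subr_eq0 -/(p s) ps0.
  have pn0 : p (~~ s) != 0.
    apply: contra neq; rewrite subr_eq0 => /eqP Dn.
    by apply/eqP; have := sumD s; lra.
  have un0 b : side b = ~~ s -> u b = 0.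
    move=> sb; have /eqP := uv b; rewrite sb negbK -!/(p _) ps0 mul0r.
    by rewrite mulf_eq0 (negPf pn0) => /eqP.
  move=> a; have [/eqP sa|sa] := boolP (side a == s); last first.
    by apply: un0; move: sa; case: (side a) s {ps0 Ds pn0} => [] [].
  have := adju a; rewrite big1 => [|b /side_e sb]; last by rewrite un0 // sb sa.
  move=> /esym/eqP; rewrite mulf_eq0 => /orP[|/eqP//].
  by rewrite sa Ds => /eqP; have := D_gt0 s; rewrite Ds => ? ?; lra.
have [/degenerate//|pt] := eqVneq (p true) 0.
have [/degenerate//|pf] := eqVneq (p false) 0.
have p0 s : p s != 0 by case: s.
(* The coefficient left on [u] after eliminating [v] between [uv] and [adj_uv]. *)
pose k s := p s ^+ 2 * (D s - 2 * mu) - p (~~ s) ^+ 2 * (D s - 2 * lambda).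
have ku a : k (side a) * u a = 0.
  have := uv a; have := adj_uv a; rewrite -!/(p _) /k => h1 h2.
  transitivity (p (side a) * (D (side a) - 2 * mu) * (p (side a) * u a) -
    p (~~ side a) * (p (~~ side a) * ((D (side a) - 2 * lambda) * u a))).
    by ring.
  by rewrite h1 h2; ring.
have regular s : k s != 0 -> forall a, u a = 0.
  move=> ks; have u0 a : side a = s -> u a = 0.
    by move=> sa; have /eqP := ku a; rewrite sa mulf_eq0 (negPf ks) => /eqP.
  have uv0 a : side a = s -> u a = 0 /\ v a = 0.
    move=> sa; split; first exact: u0.
    have /esym/eqP := uv a; rewrite u0 // mulr0 mulf_eq0 => /orP[|/eqP//].
    by rewrite -/(p _) (negPf (p0 _)).
  move=> a; have [/eqP sa|sa] := boolP (side a == s); first exact: u0.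
  by apply: (half s) => //; move: sa; case: (side a) s {ks u0 uv0} => [] [].
have [kt|/regular//] := eqVneq (k true) 0.
have [kf|/regular//] := eqVneq (k false) 0.
(* If both coefficients vanish, multiplying the two equations gives this product, none of whose
   factors can be zero. *)
have : (p true * p false) ^+ 2 * (2 * (D true + D false) * (mu - lambda)) = 0.
  move/eqP: kt; rewrite subr_eq0 => /eqP kt.
  move/eqP: kf; rewrite subr_eq0 => /eqP /= kf.
  have := congr2 *%R kt kf; rewrite /= => kk.
  have -> : 2 * (D true + D false) * (mu - lambda) =
    (D true - 2 * mu) * (D false - 2 * mu) -
    (D true - 2 * lambda) * (D false - 2 * lambda) by rewrite mu_def; ring.
  rewrite mulrBr; apply/eqP; rewrite subr_eq0; apply/eqP.
  by rewrite exprMn -mulrACA kk; ring.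
move=> /eqP; rewrite expr2 !mulf_eq0 (negPf pt) (negPf pf) /=.
rewrite pnatr_eq0 /= subr_eq0 [mu == _]eq_sym (negPf neq) orbF => /eqP.
by have := D_gt0 true; have := D_gt0 false; lra.
Qed.

Lemma eigenprojector_diag_side lambda a b : side a = side b ->
  E lambda a a = E lambda b b.
Proof.
move=> sab; pose x r a := E r a a.
have adjx r : forall a, \sum_(b | e a b) centered (x r) b =
    (D (side a) - 2 * r) * centered (x r) a.
  by have [gamma] := adjacency_diag r; exact: adjacency_centered.
suff : centered (x lambda) a = centered (x lambda) b.
  by rewrite /centered sab => /addIr.
have [self|nself] := eqVneq lambda (dual_eigenvalue lambda).
  exact: centered_selfdual self (adjx lambda) a b sab.
(* The factors in [diag_dual] are constant on each side, so the relation passes to side means. *)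
have dual c : (D (side c) - lambda) * centered (x lambda) c =
    (D (~~ side c) - lambda) * centered (x (dual_eigenvalue lambda)) c.
  rewrite /centered !mulrBr diag_dual //; congr (_ - _).
  rewrite /side_mean !mulrA; congr (_ / _); rewrite !mulr_sumr.
  by apply: eq_bigr => d /eqP <-; rewrite /x diag_dual.
by rewrite !(centered_dual_eq0 nself (adjx _) (adjx _) dual).
Qed.

(** * Counting closed walks *)

Fixpoint walk_coef (lambda : R) (l : nat) (s : bool) : R :=
  if l is l'.+1 then walk_coef lambda l' (~~ s) * (D s - lambda) else 1.

(** The left side is the [l]-th power of the adjacency matrix applied to [f]. Splitting off the
    first step changes the side and contributes the factor [D (side a) - lambda]. *)
Lemma sum_walks lambda f : laplacian_eigenfunction e lambda f -> forall l a,
  \sum_(w : l.-tuple T | path e a w) f (last a w) =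
  walk_coef lambda l (side a) * f a.
Proof.
move=> /laplacian_eigenfunctionP eigf; elim=> [|l IHl] a.
  rewrite (bigD1 [tuple]) //= big1 ?addr0 ?mul1r // => w.
  by rewrite (tuple0 w) => /andP[_ /eqP].
rewrite (reindex (fun p : T * l.-tuple T => [tuple of p.1 :: p.2])) /=; last first.
  exists (fun w => (thead w, [tuple of behead w])) => [[b w] _|w _] /=.
    by rewrite theadE; congr (_, _); apply: val_inj.
  by apply: val_inj; rewrite /= [in RHS](tuple_eta w).
rewrite -(pair_big_dep (e a) (fun b (w : l.-tuple T) => path e b w)
  (fun b (w : l.-tuple T) => f (last b w))) /=.
rewrite -mulrA -eigf mulr_sumr; apply: eq_bigr => b eab.
by rewrite IHl (side_e eab).
Qed.

Lemma closed_walks_side l a b : side a = side b ->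
  #|closed_walks e l a| = #|closed_walks e l b|.
Proof.
move=> sab; have [rs sum_rs] := eigenprojector_entry_sum R e.
have closedE c : #|closed_walks e l c|%:R =
    \sum_(r <- rs) walk_coef r l (side c) * E r c c.
  rewrite -sum1dep_card natr_sum /=.
  (* The condition that a walk ends at [c] is an entry of the identity, written as the sum of the
     eigenprojectors. *)
  transitivity (\sum_(w : l.-tuple T | path e c w)
      \sum_(r <- rs) E r (last c w) c).
    rewrite big_mkcondr; apply: eq_bigr => w _.
    by rewrite sum_rs; case: ifP.
  rewrite exchange_big; apply: eq_bigr => r _.
  by rewrite (sum_walks (eigenprojector_entry_eigen sym_e irr_e r c)).
apply/eqP; rewrite -(eqr_nat R) !closedE sab; apply/eqP.
by apply: eq_bigr => r _; rewrite (eigenprojector_diag_side r sab).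
Qed.

End Biregular.

Theorem mainTheorem13 (R : realType) (T : finType) (e : rel T)
    (V1 V2 : {set T}) (d1 d2 : nat)
    (e_simple : simple_graph e)
    (e_connected : connected_graph e)
    (e_bipartite : bipartition e V1 V2)
    (e_biregular : biregular e V1 V2 d1 d2)
    (e_rigid : edge_rigid R e)
    (e_edge : exists a b : T, e a b) :
  walk_biregular e V1 V2.
Proof.
case: e_simple e_bipartite e_biregular.
move=> sym_e irr_e [cover disj edges] [deg1 deg2].
pose side a := a \in V1.
have V2E b : (b \in V2) = ~~ side b.
  have : b \in V1 :|: V2 by rewrite cover inE.
  rewrite inE /side; case: (boolP (b \in V1)) => //= bV1 _.
  by apply/negbTE; rewrite (disjointFr disj bV1).
have side_e a b : e a b -> side b = ~~ side a.
  by move/edges; rewrite !V2E /side; case: (a \in V1); case: (b \in V1).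
pose D (s : bool) : R := (if s then d1 else d2)%:R.
have deg_e a : \sum_(b | e a b) (1 : R) = D (side a).
  have -> : \sum_(b | e a b) (1 : R) = (degree e a)%:R.
    by rewrite /degree -sum1dep_card natr_sum.
  rewrite /D; case sa: (side a); first by rewrite deg1.
  by rewrite deg2 // V2E sa.
(* An edge has one end on each side, so both sides are inhabited and both degrees are positive. *)
have nbr s : exists a b, side a = s /\ e a b.
  case: e_edge => a [b eab]; have [<-|sa] := eqVneq (side a) s.
    by exists a, b.
  exists b, a; rewrite sym_e (side_e _ _ eab); split=> //.
  by case: (side a) s sa => [] [].
have D_gt0 s : 0 < D s.
  have [a [b [<- eab]]] := nbr s; rewrite -deg_e (bigD1 b) //=.
  by rewrite ltr_pwDl // sumr_ge0.
have occ s : exists a, side a = s by have [a [_ [sa _]]] := nbr s; exists a.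
move=> l; have [[a1 sa1] [a2 sa2]] := (occ true, occ false).
(* The constants are the counts at one chosen vertex of each side. *)
exists #|closed_walks e l a1|, #|closed_walks e l a2|.
split=> a aV; apply: (closed_walks_side sym_e side_e deg_e D_gt0 occ irr_e
  e_connected e_rigid).
  by rewrite sa1.
by rewrite sa2; apply/negbTE; rewrite -V2E.
Qed.
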